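(* Let $X\ne\{0\}$ be a real reflexive Banach space. Let $b:X\to(-\infty,\infty]$ be lower semicontinuous, convex and proper, with $U:=\mathrm{Int}(\mathrm{dom}(b))\ne\emptyset$, and suppose $b$ is Gâteaux differentiable in $U$. Let $S\subseteq\mathrm{dom}(b)$ be nonempty, closed and convex, with $S\cap U\neq\emptyset$, and suppose $b$ is strictly convex on $S$. Let $f:\mathrm{dom}(b)\to\mathbb{R}$ be Gâteaux differentiable in $U$, and let $g:S\to(-\infty,\infty]$ be proper, lower semicontinuous and convex. Let $\tilde g:X\to(-\infty,\infty]$ be defined by $\tilde g(x):=g(x)$ if $x\in S$ and $\tilde g(x):=\infty$ if $x\notin S$. Assume that there exists a point in $\mathrm{dom}(g)$ at which either $b$ or $g$ is continuous. Fix $L>0$, $\mu>0$ and $y\in U$, and assume that at least one of the following holds: (i) $S$ is bounded; (ii) $S$ is unbounded and $b$ is uniformly convex relative to $(S,\{y\})$ with a relative gauge $\psi$ satisfying $\lim_{t\to\infty}\psi(t)/t=\infty$. Suppose in addition that at least one of the following conditions holds: (A) $S\subseteq U$; (B) for each $x\in S\cap\partial U$, either $\partial b(x)=\emptyset$ or $\partial\tilde g(x)=\emptyset$. Then the (unique) minimizer $z$ over $S$ of the function $u_y(x):=Q_{L,\mu,S}(x,y)$, $x\in S$, satisfies $z\in S\cap U$. In particular, suppose that $X\neq\{0\}$ is a finite-dimensional real Banach space; that $b:X\to(-\infty,\infty]$ is lower semicontinuous, convex and proper, with $U:=\mathrm{Int}(\mathrm{dom}(b))\ne\emptyset$, and $b$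 is Gâteaux differentiable in $U$ and essentially smooth on $U$; that $S\subseteq\mathrm{dom}(b)$ is nonempty, closed and convex, with $S\cap U\neq\emptyset$, and $b$ is strictly convex on $S$; that $f:\mathrm{dom}(b)\to\mathbb{R}$ is Gâteaux differentiable in $U$; that $g:S\to(-\infty,\infty]$ is proper, lower semicontinuous and convex; that there exists a point in $\mathrm{dom}(g)$ at which either $b$ or $g$ is continuous; that $L>0$, $\mu>0$ and $y\in U$; and that either $S$ is bounded, or $S$ is unbounded and $b$ is uniformly convex relative to $(S,\{y\})$ with a relative gauge $\psi$ satisfying $\lim_{t\to\infty}\psi(t)/t=\infty$ (neither (A) nor (B) being assumed). Then the unique minimizer $z$ of $u_y$ over $S$ satisfies $z\in S\cap U$.
   Context: $\mathrm{dom}(h)$ is the set where $h$ is finite ($<\infty$). $\partial U$ is the topological boundary of $U$, whereas $\partial b$, $\partial\tilde g$ denote subdifferentials of convex functions on $X$. The Bregman divergence of $b$ is $B(x,y):=b(x)-b(y)-\langle b'(y),x-y\rangle$ for $(x,y)\in\mathrm{dom}(b)\times U$ and $B(x,y):=\infty$ otherwise, where $b'$ is the Gâteaux gradient of $b$. For $x\in S$, $y\in U$, $$Q_{L,\mu,S}(x,y):=f(y)+\langle f'(y),x-y\rangle+\frac{L}{\mu}B(x,y)+g(x).$$ For nonempty $S_1,S_2\subseteq\mathrm{dom}(b)$, $b$ is uniformly convex relative to $(S_1,S_2)$ with relative gauge $\psi:[0,\infty)\to[0,\infty]$ if $\psi(t)>0$ for $t>0$ and $b(\lambda x+(1-\lambda)w)+\lambda(1-\lambda)\psi(\|x-w\|)\le\lambda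 b(x)+(1-\lambda)b(w)$ for all $\lambda\in(0,1)$, $(x,w)\in S_1\times S_2$. Under the stated hypotheses $u_y$ has a unique minimizer in $S$. $b$ is essentially smooth on $U=\mathrm{Int}(\mathrm{dom}(b))$ if $U\neq\emptyset$, $b$ is proper, convex and Gâteaux differentiable on $U$, and $\lim_{i\to\infty}\|b'(x_i)\|=\infty$ for every sequence $(x_i)$ in $U$ which converges to a boundary point of $U$. *)

(* Defs.v *)
From HB Require Import structures.
From mathcomp Require Import all_boot all_order all_algebra.
From mathcomp Require Import all_classical all_reals all_analysis.

Set Implicit Arguments.
Unset Strict Implicit.
Unset Printing Implicit Defensive.

Import Order.TTheory GRing.Theory Num.Theory.
Import numFieldNormedType.Exports.

Local Open Scope classical_set_scope.
Local Open Scope ring_scope.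

Definition boundary (T : topologicalType) (A : set T) : set T :=
  closure A `\` A°.

(** The topological dual, as a set of functions, with the operator norm
    ([sup] is the real supremum; the set below is bounded for [p] in the
    dual). *)
Definition dual (R : realType) (X : normedModType R) : set (X -> R) :=
  [set p : X -> R | scalar p /\ continuous p].

Definition dual_norm (R : realType) (X : normedModType R) (p : X -> R) : R :=
  sup [set `|p x| | x in [set x : X | `|x| <= 1]].

(** Surjectivity of the canonical embedding of [X] into its bidual: an element
    of the bidual is a map [Phi] whose restriction to the dual is linear and
    bounded for the operator norm. *)
Definition reflexive_space (R : realType) (X : normedModType R) : Prop :=
  forall Phi : (X -> R) -> R,
    (forall (a : R) (p q : X -> R), dual p -> dual q ->
       Phi (fun v => a * p v + q v) = a * Phi p + Phi q) ->
    (exists M : R, forall p, dual p -> `|Phi p| <= M * dual_norm p) ->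
    exists x : X, forall p, dual p -> Phi p = p x.

Definition finite_dimensional (R : realType) (X : normedModType R) : Prop :=
  exists (n : nat) (e : 'I_n -> X),
    forall x, exists c : 'I_n -> R, x = \sum_(i < n) c i *: e i.

(** Functions with values in (-oo, +oo] are maps to [\bar R]; a function which
    in the mathematical text is only defined on a subset [A] of [X] is a map on
    [X] of which only the values on [A] are constrained or used. *)
Definition dom (R : realType) (X : normedModType R) (h : X -> \bar R) : set X :=
  [set x | (h x < +oo)%E].

Definition proper_on (R : realType) (X : normedModType R) (A : set X)
    (h : X -> \bar R) : Prop :=
  (forall x, A x -> (-oo < h x)%E) /\ (exists2 x, A x & dom h x).

Definition convex_on (R : realType) (X : normedModType R) (A : set X)
    (h : X -> \bar R) : Prop :=
  forall (x y : X) (t : R), A x -> A y -> 0 < t < 1 ->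
    (h (t *: x + (1 - t) *: y)%R <= t%:E * h x + (1 - t)%:E * h y)%E.

Definition strictly_convex_on (R : realType) (X : normedModType R) (A : set X)
    (h : X -> \bar R) : Prop :=
  forall (x y : X) (t : R), A x -> A y -> x != y -> 0 < t < 1 ->
    (h (t *: x + (1 - t) *: y)%R < t%:E * h x + (1 - t)%:E * h y)%E.

(** The Gâteaux gradient of [h] at [x] is [fun v => 'D_v h x]. *)
Definition gateaux_differentiable (R : realType) (X : normedModType R)
    (h : X -> R) (x : X) : Prop :=
  (forall v, derivable h x v) /\ dual (fun v => 'D_v h x).

(** For an extended-valued [b] and [x] interior to [dom b], [b] is finite near
    [x], so that [fine \o b] has the derivatives of [b] at [x]. *)
Definition gateaux_gradient (R : realType) (X : normedModType R)
    (b : X -> \bar R) (x : X) : X -> R :=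
  fun v => 'D_v (fine \o b) x.

Definition subdifferential (R : realType) (X : normedModType R)
    (h : X -> \bar R) (x : X) : set (X -> R) :=
  [set p | dual p /\ forall w, (h x + (p (w - x)%R)%:E <= h w)%E].

Definition bregman (R : realType) (X : normedModType R) (b : X -> \bar R)
    (x y : X) : \bar R :=
  if (x \in dom b) && (y \in ((dom b)° : set X))
  then (b x - b y - (gateaux_gradient b y (x - y)%R)%:E)%E else +oo%E.

Definition Qfun (R : realType) (X : normedModType R) (b : X -> \bar R)
    (f : X -> R) (g : X -> \bar R) (L mu : R) (x y : X) : \bar R :=
  ((f y)%:E + ('D_(x - y) f y)%:E + (L / mu)%:E * bregman b x y + g x)%E.

Definition extend_by_infty (R : realType) (X : normedModType R) (S : set X)
    (g : X -> \bar R) : X -> \bar R :=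
  fun x => if x \in S then g x else +oo%E.

(** [psi] is a relative gauge: only its values on [0, +oo) matter. *)
Definition uniformly_convex_relative (R : realType) (X : normedModType R)
    (b : X -> \bar R) (S1 S2 : set X) (psi : R -> \bar R) : Prop :=
  [/\ S1 !=set0 /\ S2 !=set0,
      S1 `<=` dom b /\ S2 `<=` dom b,
      (forall t : R, 0 <= t -> (0 <= psi t)%E),
      (forall t : R, 0 < t -> (0 < psi t)%E)
    & forall (l : R) (x w : X), 0 < l < 1 -> S1 x -> S2 w ->
        (b (l *: x + (1 - l) *: w)%R + (l * (1 - l))%:E * psi `|(x - w)%R|%R
           <= l%:E * b x + (1 - l)%:E * b w)%E].

Definition essentially_smooth (R : realType) (X : normedModType R)
    (b : X -> \bar R) : Prop :=
  let U := (dom b)° in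
  [/\ U !=set0, proper_on setT b, convex_on setT b,
      (forall x, U x -> gateaux_differentiable (fine \o b) x)
    & forall (u : nat -> X) (l : X), (forall i, U (u i)) ->
        boundary U l -> u i @[i --> \oo] --> l ->
        dual_norm (gateaux_gradient b (u i)) @[i --> \oo] --> +oo].

Definition minimizer (R : realType) (X : normedModType R) (S : set X)
    (u : X -> \bar R) (z : X) : Prop :=
  S z /\ forall x, S x -> (u z <= u x)%E.

(* Main.v *)
Require Import Defs.
From HB Require Import structures.
From mathcomp Require Import all_boot all_order all_algebra.
From mathcomp Require Import all_classical all_reals all_analysis.
From mathcomp Require Import ring lra.

Set Implicit Arguments.
Unset Strict Implicit.
Unset Printing Implicit Defensive.

Import Order.TTheory GRing.Theory Num.Theory.
Import numFieldNormedType.Exports.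

Local Open Scope classical_set_scope.
Local Open Scope ring_scope.

(** Up to constants, the function to be minimized is [l + c b + g] on [S], with
    [l] a continuous linear functional and [c = L / mu].

    Existence. Its sublevel sets are closed by lower semicontinuity, convex, and
    bounded: uniform convexity gives [psi |x - y| <= B(x, y)], which is
    superlinear, while [l] and [g] decrease at most linearly. In a reflexive
    space nested nonempty closed bounded convex sets have a common point: an
    ultrafilter containing them defines, by taking limits of functionals, an
    element of the bidual; it is represented by a point, and a continuous
    functional separating this point from one of the sets would be contradictory
    ([reflexive_minimizer]). Uniqueness is strict convexity of [b] on [S].

    Location. Under (A) there is nothing to prove. Otherwise, suppose that the
    minimizer [z] is not in [U]. Then [z] is a boundary point of [U]. The
    continuity hypothesis yields a point of [S], interior to [dom b], where [g]
    is finite, and [b] is bounded above near that point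
    ([lsc_convex_locally_bounded], by the Baire category theorem). This is what
    the subdifferential sum rule needs, so minimality of [z] splits into a
    subgradient of [b] at [z] and one of the extension of [g] at [z]
    ([subgradient_split]), contradicting (B).

    Finite dimension. Such a space is reflexive ([finite_dimensional_reflexive]),
    and an essentially smooth [b] has no subgradient at a boundary point [x] of
    [U] lying in [dom b]: a subgradient there would bound the gradients of [b]
    along the segment from [x] to an interior point
    ([essentially_smooth_boundary]). So (B) holds automatically.

    All separation arguments rest on one form of the Hahn-Banach theorem, stated
    for epigraphs: a convex set of [X * R] which is nonnegative above [0] and
    contains a horizontal disc lies above the graph of a continuous linear
    functional ([convex_linear_minorant]). *)

(** * Hahn-Banach theorem for cones and epigraphs *)

(** The lower boundary of [K] is a sublinear function. That of a maximal cone [B]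
    containing [K] and nonnegative above [0] is linear: if a point [(v, s)]
    cannot be added to [B], this is because [B] has a point over [- v] of height
    below [- s]. Hence the infimum [p] of the heights of [B] satisfies
    [p (- v) = - p v], and a sublinear odd function is linear. *)
Lemma cone_linear_minorant (R : realType) (V : lmodType R) (K : set (V * R)) :
  (forall v w s t, K (v, s) -> K (w, t) -> K (v + w, s + t)) ->
  (forall (a : R) v s, 0 < a -> K (v, s) -> K (a *: v, a * s)) ->
  (forall s, K (0, s) -> 0 <= s) ->
  (forall v, exists s, K (v, s)) ->
  exists p : V -> R, scalar p /\ forall v s, K (v, s) -> p v <= s.
Proof.
move=> KD KZ K0 Kfull.
pose cone (E : set (V * R)) := [/\
  (forall v w s t, E (v, s) -> E (w, t) -> E (v + w, s + t)),
  (forall (a : R) v s, 0 < a -> E (v, s) -> E (a *: v, a * s)) &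
  (forall s, E (0, s) -> 0 <= s)].
have [F Ftot|A [[AD AZ A0] Amax]] := @Zorn_bigcup _ [set E | cone (K `|` E)].
  move=> Fchain; have FU E : F E -> E `<=` \bigcup_(X in F) X.
    by move=> FE; exact: bigcup_sup.
  split.
  - move=> v w s t [Kv|[E FE Ev]] [Kw|[E' FE' Ew]].
    + by left; exact: KD.
    + have [+ _ _] := Ftot _ FE' => /(_ v w s t (or_introl Kv) (or_intror Ew)).
      by case; [left|move/(FU _ FE'); right].
    + have [+ _ _] := Ftot _ FE => /(_ v w s t (or_intror Ev) (or_introl Kw)).
      by case; [left|move/(FU _ FE); right].
    + have [sub|sub] := Fchain _ _ FE FE'.
      * have [+ _ _] := Ftot _ FE'.
        move=> /(_ v w s t (or_intror (sub _ Ev)) (or_intror Ew)).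
        by case; [left|move/(FU _ FE'); right].
      * have [+ _ _] := Ftot _ FE.
        move=> /(_ v w s t (or_intror Ev) (or_intror (sub _ Ew))).
        by case; [left|move/(FU _ FE); right].
  - move=> a v s a0 [Kv|[E FE Ev]]; first by left; exact: KZ.
    have [_ + _] := Ftot _ FE => /(_ a v s a0 (or_intror Ev)).
    by case; [left|move/(FU _ FE); right].
  - move=> s [|[E FE Es]]; first exact: K0.
    by have [_ _] := Ftot _ FE; apply; right.
set B := K `|` A in AD AZ A0.
(* By maximality, the cone generated by [B] and a point outside [B] must contain
   a point of negative height over 0. *)
have dich v s : ~ B (v, s) -> exists2 t, B (- v, t) & t < - s.
  move=> nB; apply: contrapT => nt.
  pose C := B `|` [set x : V * R | exists w t a,
    [/\ 0 < a, (w, t) = 0 \/ B (w, t) & x = (w + a *: v, t + a * s)]].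
  have BC : K `|` C = C by rewrite /C /B !setUA setUid.
  apply: (Amax C).
    split; first by move=> x Ax; left; right.
    move=> CA; apply: nB; right; apply: CA; right; exists 0, 0, 1.
    by split=> //; [left|rewrite !add0r scale1r mul1r].
  have BD w t w' t' : (w, t) = 0 \/ B (w, t) -> (w', t') = 0 \/ B (w', t') ->
    (w + w', t + t') = 0 \/ B (w + w', t + t').
    move=> [[-> ->]|Bw] [[-> ->]|Bw']; rewrite ?add0r ?addr0; [by left|by right..|].
    by right; exact: AD.
  rewrite /= BC; split.
  - move=> v1 v2 s1 s2 [B1|[w1 [t1 [a1 [a10 B1 [-> ->]]]]]]
      [B2|[w2 [t2 [a2 [a20 B2 [-> ->]]]]]].
    + by left; exact: AD.
    + right; exists (v1 + w2), (s1 + t2), a2; split=> //; last by rewrite !addrA.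
      by apply: BD => //; right.
    + right; exists (w1 + v2), (t1 + s2), a1; split=> //.
        by apply: BD => //; right.
      by rewrite addrAC (addrAC t1).
    + right; exists (w1 + w2), (t1 + t2), (a1 + a2); split; first exact: addr_gt0.
        exact: BD.
      by rewrite addrACA scalerDl (addrACA t1) mulrDl.
  - move=> a v1 s1 a0 [B1|[w1 [t1 [a1 [a10 B1 [-> ->]]]]]].
      by left; exact: AZ.
    right; exists (a *: w1), (a * t1), (a * a1); split; first exact: mulr_gt0.
      case: B1 => [[-> ->]|B1]; first by left; rewrite scaler0 mulr0.
      by right; exact: AZ.
    by rewrite scalerDr scalerA mulrDr mulrA.
  - move=> t [|[w [t1 [a [a0 B1 [/esym w0 ->]]]]]]; first exact: A0.
    have {w0}wE : w = - (a *: v) by apply/eqP; rewrite -addr_eq0 w0.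
    rewrite leNgt; apply/negP => lt0; apply: nt.
    case: B1 => [[w0 t10]|Bw].
      have v0 : v = 0.
        by move/eqP: wE; rewrite w0 eq_sym oppr_eq0 scaler_eq0 gt_eqF //= => /eqP.
      have s_lt0 : s < 0 by move: lt0; rewrite t10 add0r pmulr_rlt0.
      (* Over 0, the ray of [K] through [s0] reaches heights below [- s]. *)
      have [s0 Ks0] := Kfull 0; have s00 := K0 _ Ks0.
      have e0 : 0 < - s / (s0 + 1) by apply: divr_gt0; lra.
      exists (- s / (s0 + 1) * s0).
        by left; rewrite v0 oppr0 -[0](scaler0 _ (- s / (s0 + 1))); exact: KZ.
      rewrite mulrAC ltr_pdivrMr; last lra.
      by rewrite mulrDr mulr1 ltrDl oppr_gt0.
    exists (a^-1 * t1).
      have -> : - v = a^-1 *: w by rewrite wE scalerN scalerA mulVf ?gt_eqF // scale1r.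
      by apply: AZ => //; rewrite invr_gt0.
    by rewrite mulrC ltr_pdivrMr // mulrC mulrN; lra.
have up v s s' : B (v, s) -> s < s' -> B (v, s').
  move=> Bs ss'; apply: contrapT => /dich[t Bt tlt].
  have := AD _ _ _ _ Bs Bt; rewrite subrr => /A0; lra.
have opp v s t : B (v, s) -> B (- v, t) -> 0 <= s + t.
  by move=> Bs Bt; have := AD _ _ _ _ Bs Bt; rewrite subrr => /A0.
have Bfull v : exists s, B (v, s) by have [s] := Kfull v; exists s; left.
pose p v := inf [set s | B (v, s)].
have hinf v : has_inf [set s | B (v, s)].
  split; first exact: Bfull.
  have [t Bt] := Bfull (- v); exists (- t) => s /= Bs.
  by have := opp _ _ _ Bs Bt; lra.
have p_le v s : B (v, s) -> p v <= s.
  by move=> Bs; apply: ge_inf => //; case: (hinf v).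
have p_ge v m : (forall s, B (v, s) -> m <= s) -> m <= p v.
  by move=> H; apply: lb_le_inf => //; exact: Bfull.
have p_lt v s : p v < s -> B (v, s).
  move=> ps; have [t Bt ts] := inf_lt (Bfull v) ps; exact: up Bt ts.
have pD v w : p (v + w) <= p v + p w.
  apply/ler_addgt0Pr => e e0.
  rewrite (_ : _ + e = (p v + e / 2) + (p w + e / 2)); last by lra.
  by apply: p_le; apply: AD; apply: p_lt; lra.
have pZ a v : 0 < a -> p (a *: v) <= a * p v.
  move=> a0; rewrite mulrC -ler_pdivrMr //; apply: p_ge => s Bs.
  by rewrite ler_pdivrMr // mulrC; apply: p_le; exact: AZ.
have pN v : p (- v) = - p v.
  apply/eqP; rewrite eq_le; apply/andP; split.
    apply/ler_addgt0Pr => e e0.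
    have [|t Bt tlt] := @dich v (p v - e); first by move=> /p_le; lra.
    by apply: (le_trans (p_le _ _ Bt)); lra.
  apply: (p_ge) => t Bt; rewrite lerNl; apply: p_ge => s Bs.
  by have := opp _ _ _ Bs Bt; lra.
have pDE v w : p (v + w) = p v + p w.
  apply/eqP; rewrite eq_le pD /=.
  by have := pD (- v) (- w); rewrite -opprD !pN; lra.
have pZpos a v : 0 < a -> p (a *: v) = a * p v.
  move=> a0; apply/eqP; rewrite eq_le pZ //=.
  by have := pZ a (- v) a0; rewrite scalerN !pN; lra.
have p0 : p 0 = 0 by have := pDE 0 0; rewrite addr0; lra.
exists p; split; last by move=> v s Kvs; apply: p_le; left.
move=> a v w; rewrite pDE; congr (_ + _).
have [a0|a0|->] := ltgtP a 0; last by rewrite scale0r p0 mul0r.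
  have := pZpos (- a) v; rewrite oppr_gt0 => /(_ a0).
  by rewrite scaleNr pN mulNr => /oppr_inj.
exact: pZpos.
Qed.

(** * Linear functionals and the dual norm *)

Section Scalar.
Context (R : realType) (V : lmodType R) (p : V -> R) (sp : scalar p).

Lemma functional0 : p 0 = 0.
Proof. by have := sp 1 0 0; rewrite scaler0 add0r; lra. Qed.

Lemma functionalD v w : p (v + w) = p v + p w.
Proof. by have := sp 1 v w; rewrite scale1r mul1r. Qed.

Lemma functionalZ a v : p (a *: v) = a * p v.
Proof. by have := sp a v 0; rewrite addr0 functional0 addr0. Qed.

Lemma functionalN v : p (- v) = - p v.
Proof. by rewrite -scaleN1r functionalZ mulN1r. Qed.

Lemma functionalB v w : p (v - w) = p v - p w.
Proof. by rewrite functionalD functionalN. Qed.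

End Scalar.

Section Dual.
Context (R : realType) (X : normedModType R).
Implicit Types (p : X -> R) (v : X).

Lemma dual_bounded p : dual p -> exists2 C, 0 < C & forall v, `|p v| <= C * `|v|.
Proof.
move=> [sp cp].
pose l : {linear X -> R^o} := HB.pack p (GRing.isLinear.Build _ _ _ _ _ sp).
have /linear_boundedP : bounded_near l (nbhs 0).
  by apply/linear_bounded_continuous; exact: cp.
move=> /pinfty_ex_gt0[C C0 H]; by exists C.
Qed.

(** A one-sided bound on a ball is enough, because [p (- v) = - p v]. *)
Lemma dual_of_bound p (r M : R) : scalar p -> 0 < r ->
  (forall v, `|v| < r -> p v <= M) -> dual p.
Proof.
move=> sp r0 H; split=> //.
pose l : {linear X -> R^o} := HB.pack p (GRing.isLinear.Build _ _ _ _ _ sp).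
apply: (@bounded_linear_continuous _ _ _ l); apply/ex_bound; exists M.
apply/nbhs_norm0P; exists r => //= v /= vr.
have := H (- v); rewrite normrN (functionalN sp) => /(_ vr).
by have := H v vr; rewrite ler_norml; lra.
Qed.

Lemma dual_norm_le p (C : R) :
  (forall v, `|v| <= 1 -> `|p v| <= C) -> dual_norm p <= C.
Proof.
move=> H; apply: sup_le_ub; first by exists `|p 0|, 0 => //=; rewrite normr0.
by move=> _ [v /= v1 <-]; exact: H.
Qed.

Lemma le_dual_norm p v : dual p -> `|p v| <= dual_norm p * `|v|.
Proof.
move=> dp; have [C C0 HC] := dual_bounded dp; have sp := dp.1.
have [->|v0] := eqVneq v 0; first by rewrite (functional0 sp) !normr0 mulr0.
have nv : 0 < `|v| by rewrite normr_gt0.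
rewrite -ler_pdivrMr //; apply: ub_le_sup.
  exists C => _ [w /= w1 <-]; apply: le_trans (HC w) _.
  by rewrite -[leRHS]mulr1 ler_pM2l.
exists (`|v|^-1 *: v) => /=; first by rewrite normrZ normfV normr_id mulVf ?gt_eqF.
by rewrite (functionalZ sp) normrM normfV normr_id mulrC.
Qed.

Lemma dual_norm_ge0 p : 0 <= dual_norm p.
Proof.
have [H|H] := pselect (has_sup [set `|p x| | x in [set x : X | `|x| <= 1]]).
  apply: (@le_trans _ _ `|p 0|) => //; apply: ub_le_sup; first exact: H.2.
  by exists 0 => //=; rewrite normr0.
by rewrite /dual_norm sup_out.
Qed.

Lemma dualN p : dual p -> dual (fun v => - p v).
Proof.
move=> [sp cp]; split.
  by move=> a v w; rewrite /= (sp a v w) opprD mulrN.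
by move=> x; apply: cvgN; exact: cp.
Qed.

Lemma dual_lincomb (a : R) p q : dual p -> dual q -> dual (fun v => a * p v + q v).
Proof.
move=> [sp cp] [sq cq]; split.
  by move=> c v w; rewrite /= (sp c v w) (sq c v w); ring.
by move=> x; apply: cvgD; [apply: cvgMr; exact: cp|exact: cq].
Qed.

(** The disc contained in [E] ensures that the cone generated by [E] reaches every
    [v], and it bounds on a ball the functional obtained from this cone. *)
Lemma convex_linear_minorant (E : set (X * R)) (r M : R) :
  (forall v w s t a, E (v, s) -> E (w, t) -> 0 < a < 1 ->
     E (a *: v + (1 - a) *: w, a * s + (1 - a) * t)) ->
  (forall s, E (0, s) -> 0 <= s) ->
  0 < r -> (forall v, `|v| < r -> E (v, M)) ->
  exists p, dual p /\ forall v s, E (v, s) -> p v <= s.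
Proof.
move=> Ecvx E0 r0 EM.
pose K := [set x : X * R | exists2 a : R, 0 < a & E (a *: x.1, a * x.2)].
have [||||p [sp pK]] := @cone_linear_minorant R X K.
- move=> v w s t [a /= a0 Ea] [c /= c0 Ec].
  have ac0 : 0 < a + c by lra.
  exists (a * c / (a + c)) => /=; first by rewrite divr_gt0 ?mulr_gt0.
  have cac : 0 < c / (a + c) < 1 by rewrite divr_gt0 //= ltr_pdivrMr //; lra.
  have := Ecvx _ _ _ _ _ Ea Ec cac.
  have -> : 1 - c / (a + c) = a / (a + c) by field; lra.
  rewrite !scalerA !mulrA scalerDr mulrDr.
  by congr (E (_ *: _ + _ *: _, _ * _ + _ * _)); field; lra.
- move=> a v s a0 [c /= c0 Ec]; exists (c / a) => /=; first exact: divr_gt0.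
  by rewrite scalerA mulrA divfK ?gt_eqF.
- by move=> s [a /= a0]; rewrite scaler0 => /E0; rewrite pmulr_rge0.
- move=> v; have n0 : 0 < `|v| + 1 by rewrite ltr_wpDl.
  have a0 : 0 < r / (`|v| + 1) by exact: divr_gt0.
  exists ((r / (`|v| + 1))^-1 * M), (r / (`|v| + 1)) => //=.
  rewrite mulVKf ?gt_eqF //; apply: EM.
  by rewrite normrZ gtr0_norm // mulrAC ltr_pdivrMr // ltr_pM2l // ltrDl.
have pE v s : E (v, s) -> p v <= s.
  by move=> Es; apply: pK; exists 1 => //=; rewrite scale1r mul1r.
exists p; split=> //; apply: (dual_of_bound sp r0) => v vr.
exact/pE/EM.
Qed.

End Dual.

(** * Subgradients and separation of convex sets *)

Definition convex_subset (R : realType) (V : lmodType R) (A : set V) : Prop :=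
  forall v w (a : R), A v -> A w -> 0 < a < 1 -> A (a *: v + (1 - a) *: w).

Definition convex_real_on (R : realType) (V : lmodType R) (A : set V) (F : V -> R) :
    Prop :=
  forall v w (a : R), A v -> A w -> 0 < a < 1 ->
    F (a *: v + (1 - a) *: w) <= a * F v + (1 - a) * F w.

Section Convex.
Context (R : realType) (X : normedModType R).
Implicit Types (A C D : set X) (F : X -> R) (z : X).

(** Subdifferential sum rule at a minimizer. The functional minorizes the
    inf-convolution [d |-> inf_w F1 (w + d) + F2 w], which attains its value at
    [0] for [w = z] and is bounded above near [0] because of [p]; taking [w = z],
    respectively [w + d = z], gives the two inequalities. *)
Lemma subgradient_split D1 D2 F1 F2 z p (r M : R) :
  convex_subset D1 -> convex_real_on D1 F1 ->
  convex_subset D2 -> convex_real_on D2 F2 ->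
  D1 z -> D2 z ->
  (forall x, D1 x -> D2 x -> F1 z + F2 z <= F1 x + F2 x) ->
  D2 p -> 0 < r -> (forall v, `|v| < r -> D1 (p + v) /\ F1 (p + v) <= M) ->
  exists q, [/\ dual q, forall x, D1 x -> F1 z + q (x - z) <= F1 x &
                forall x, D2 x -> F2 z - q (x - z) <= F2 x].
Proof.
move=> D1c F1c D2c F2c D1z D2z zmin D2p r0 pM.
pose E := [set x : X * R | exists w,
  [/\ D1 (w + x.1), D2 w & F1 (w + x.1) + F2 w - F1 z - F2 z <= x.2]].
have [||v vr|q [dq qE]] := @convex_linear_minorant R X E r (M + F2 p - F1 z - F2 z)
  _ _ r0.
- move=> v w s t a [x /= [D1x D2x xs]] [u /= [D1u D2u ut]] a01.
  have e : a *: x + (1 - a) *: u + (a *: v + (1 - a) *: w) =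
           a *: (x + v) + (1 - a) *: (u + w).
    by rewrite addrACA !scalerDr.
  exists (a *: x + (1 - a) *: u); rewrite /= e; split; first exact: D1c.
    exact: D2c.
  have H1 := F1c _ _ _ D1x D1u a01; have H2 := F2c _ _ _ D2x D2u a01.
  have {}xs : a * (F1 (x + v) + F2 x - F1 z - F2 z) <= a * s.
    by rewrite ler_wpM2l //; lra.
  have {}ut : (1 - a) * (F1 (u + w) + F2 u - F1 z - F2 z) <= (1 - a) * t.
    by rewrite ler_wpM2l //; lra.
  by lra.
- move=> s [w /=]; rewrite addr0 => -[D1w D2w].
  by have := zmin _ D1w D2w; lra.
- by exists p => /=; have [? ?] := pM _ vr; split=> //; lra.
exists q; split=> // x Dx.
  have := qE (x - z) (F1 x - F1 z).
  suff: E (x - z, F1 x - F1 z) by move=> H /(_ H); lra.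
  by exists z; rewrite /= subrKC; split=> //; lra.
have := qE (z - x) (F2 x - F2 z).
rewrite -(opprB x z) (functionalN dq.1) opprB.
suff: E (z - x, F2 x - F2 z) by move=> H /(_ H); lra.
by exists x; rewrite /= subrKC; split=> //; lra.
Qed.

(** The functional is a subgradient at [x] of the distance to [C]; lowering the
    distance by the radius [d] of a ball around [x] avoiding [C] keeps the
    epigraph nonnegative above [0]. *)
Lemma closed_convex_separation C x : C !=set0 -> closed C -> convex_subset C -> ~ C x ->
  exists p, dual p /\ exists2 d : R, 0 < d & forall c, C c -> p c <= p x - d.
Proof.
move=> [c0 Cc0] Ccl Ccvx nCx.
have : nbhs x (~` C) by apply: open_nbhs_nbhs; split=> //; exact: closed_openC.
move=> /nbhs_ballP[d /= d0 dC].
pose E := [set v : X * R | exists2 c, C c & `|x + v.1 - c| - d <= v.2].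
have [||v vr|p [dp pE]] :=
  @convex_linear_minorant R X E 1 (`|x - c0| + 1 - d) _ _ ltr01.
- move=> v w s t a [c /= Cc cs] [e /= Ce et] a01.
  exists (a *: c + (1 - a) *: e); first exact: Ccvx.
  have -> : x + (a *: v + (1 - a) *: w) - (a *: c + (1 - a) *: e) =
      a *: (x + v - c) + (1 - a) *: (x + w - e).
    by rewrite !(scalerBr, scalerDr) addrACA -opprD addrACA -scalerDl subrKC scale1r.
  have /andP[a0 a1] := a01; rewrite /=.
  apply: le_trans (lerB (ler_normD _ _) (lexx _)) _.
  rewrite !normrZ (gtr0_norm a0) gtr0_norm; last by lra.
  have : a * (`|x + v - c| - d) <= a * s by rewrite ler_pM2l.
  have : (1 - a) * (`|x + w - e| - d) <= (1 - a) * t by rewrite ler_pM2l //; lra.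
  by lra.
- move=> s [c /= Cc]; rewrite addr0.
  have : ~ `|x - c| < d by move=> xc; apply: (dC c) => //; rewrite -ball_normE.
  by move/negP; rewrite -leNgt; lra.
- exists c0 => //=; rewrite addrAC.
  by have := ler_normD (x - c0) v; lra.
exists p; split=> //; exists d => // c Cc.
have := pE (c - x) (- d); rewrite (functionalB dp.1).
suff: E (c - x, - d) by move=> H /(_ H); lra.
by exists c; rewrite /= ?subrKC ?subrr ?normr0 //; lra.
Qed.

(** * Weak compactness in reflexive spaces *)

Lemma ultra_bounded_cvg (T : Type) (G : set_system T) (u : T -> R) (M : R) :
  UltraFilter G -> G [set t | `|u t| <= M] -> cvg (u @ G).
Proof.
move=> UG GM; have PG : ProperFilter G by exact: ultra_proper.
have [] : `[- M, M] `&` cluster (u @ G) !=set0.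
  apply: (@segment_compact R (- M) M) => /=.
  by apply: filterS GM => t /=; rewrite in_itv/= -ler_norml.
move=> l [_ ul]; apply/cvg_ex; exists l => A Al.
have [//|nA] := in_ultra_setVsetC (u @^-1` A) UG.
have [|t [/= nAt At]] := ul (~` A) A _ Al; first exact: nA.
by case: nAt.
Qed.

(** [x] represents the functional [p |-> lim p] on the dual, the limit being taken
    along an ultrafilter finer than [F]; it belongs to every closed convex set of
    [F], for otherwise a separating functional would have its limit on the wrong
    side. *)
Lemma reflexive_weak_limit (F : set_system X) (M : R) : reflexive_space X ->
  ProperFilter F -> F [set x | `|x| <= M] ->
  exists x, forall C, closed C -> convex_subset C -> F C -> C x.
Proof.
move=> Xrefl PF FM; have [G [UG FG]] := ultraFilterLemma PF.
have PG : ProperFilter G by exact: ultra_proper.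
have GM := FG _ FM.
have cvgp p : dual p -> cvg (p @ G).
  move=> dp; have [C C0 HC] := dual_bounded dp.
  apply: (@ultra_bounded_cvg _ _ _ (C * M)).
  by apply: filterS GM => x /= xM; rewrite (le_trans (HC x)) // ler_pM2l.
have [||x Hx] := Xrefl (fun p => lim (p @ G)).
- move=> a p q dp dq; apply/cvg_lim => //.
  by apply: cvgD; [apply: cvgMr; exact: cvgp|exact: cvgp].
- exists M => p dp; rewrite -lim_norm; last exact: cvgp.
  apply: limr_le; first by apply: is_cvg_norm; exact: cvgp.
  apply: filterS GM => v /= vM; rewrite (le_trans (le_dual_norm _ dp)) // mulrC.
  by rewrite ler_wpM2r // dual_norm_ge0.
exists x => C Ccl Ccvx FC; apply: contrapT => nCx.
have [p [dp [d d0 pC]]] := closed_convex_separation (filter_ex FC) Ccl Ccvx nCx.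
suff : p x <= p x - d by lra.
rewrite -[leLHS]Hx //; apply: limr_le; first exact: cvgp.
by apply: filterS (FG _ FC) => c; exact: pC.
Qed.

(** The nonempty sublevel sets form a filter base. The infimum of [h] never
    appears, so that boundedness from below is a consequence. *)
Lemma reflexive_minimizer (D : set X) (h : X -> R) : reflexive_space X ->
  D !=set0 ->
  (forall t, [/\ closed [set x | D x /\ h x <= t],
    convex_subset [set x | D x /\ h x <= t] &
    exists M : R, forall x, D x -> h x <= t -> `|x| <= M]) ->
  exists2 z, D z & forall x, D x -> h z <= h x.
Proof.
move=> Xrefl [d0 Dd0] sub; pose C t := [set x | D x /\ h x <= t].
have FF : Filter (filter_from [set t | exists2 d, D d & h d = t] C).
  apply: filter_from_filter; first by exists (h d0), d0.
  move=> _ _ [d Dd <-] [e De <-].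
  have [de|de] := leP (h d) (h e).
    by exists (h d); [exists d|move=> x [Dx xd]; split; split=> //; exact: le_trans de].
  exists (h e); [by exists e|move=> x [Dx xe]; split; split=> //].
  by apply: le_trans xe _; exact: ltW.
have PF : ProperFilter (filter_from [set t | exists2 d, D d & h d = t] C).
  by apply: filter_from_proper => // _ [d Dd <-]; exists d; split.
have [_ _ [M DM]] := sub (h d0).
have [|z zC] := reflexive_weak_limit (M := M) Xrefl PF.
  by exists (h d0); [exists d0|move=> x [Dx xd]; exact: DM].
have zh d : D d -> C (h d) z.
  move=> Dd; have [Ccl Ccvx _] := sub (h d).
  by apply: zC => //; exists (h d) => //; exists d.
by exists z => [|d /zh[]//]; case: (zh _ Dd0).
Qed.

End Convex.

(** * Reflexivity in finite dimension *)

Section FiniteDimension.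
Context (R : realType) (X : normedModType R).

(** Induction on [n]: the induction hypothesis applies to the functionals that
    vanish at [e 0], and either all of [D] vanishes there or [D] is spanned by
    this subspace and one more functional [p0], which determines the coefficient
    of [e 0]. *)
Lemma functional_of_span n (e : 'I_n -> X) (D : set (X -> R)) (Phi : (X -> R) -> R) :
  (forall (a : R) p q, D p -> D q -> D (fun v => a * p v + q v)) ->
  (forall (a : R) p q, D p -> D q ->
     Phi (fun v => a * p v + q v) = a * Phi p + Phi q) ->
  (forall p, D p -> (forall i, p (e i) = 0) -> Phi p = 0) ->
  exists c : 'I_n -> R, forall p, D p -> Phi p = \sum_(i < n) c i * p (e i).
Proof.
elim: n e D => [|n IHn] e D Dlin Plin Pe0.
  by exists (fun=> 0) => p Dp; rewrite big_ord0; apply: Pe0 => // -[].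
have [||q [Dq q0] q1|c Pc] :=
  IHn (fun i => e (lift ord0 i)) [set p | D p /\ p (e ord0) = 0].
- move=> a p q [Dp p0] [Dq q0]; split; first exact: Dlin.
  by rewrite p0 q0 mulr0 addr0.
- by move=> a p q [Dp _] [Dq _]; exact: Plin.
- apply: Pe0 => // i.
  by have [j ->|->] := unliftP ord0 i.
have [[p0 [Dp0 p00]]|D0] := pselect (exists p0, D p0 /\ p0 (e ord0) <> 0); last first.
  exists (fun i => if unlift ord0 i is Some j then c j else 0) => p Dp.
  have pe0 : p (e ord0) = 0 by apply: contrapT => H; apply: D0; exists p.
  rewrite Pc // big_ord_recl pe0 mulr0 add0r.
  by apply: eq_bigr => i _; rewrite liftK.
move/eqP in p00.
pose c0 := (Phi p0 - \sum_(i < n) c i * p0 (e (lift ord0 i))) / p0 (e ord0).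
exists (fun i => if unlift ord0 i is Some j then c j else c0) => p Dp.
rewrite big_ord_recl unlift_none.
under eq_bigr do rewrite liftK.
pose q v := - (p (e ord0) / p0 (e ord0)) * p0 v + p v.
have Dq : [set p | D p /\ p (e ord0) = 0] q.
  by split; [exact: Dlin|rewrite /q mulNr divfK // addNr].
set k := p (e ord0) / p0 (e ord0) in q Dq *.
have E : - k * Phi p0 + Phi p =
    - k * (\sum_(i < n) c i * p0 (e (lift ord0 i))) +
    \sum_(i < n) c i * p (e (lift ord0 i)).
  rewrite -Plin // (Pc _ Dq) mulr_sumr -big_split /=.
  by apply: eq_bigr => i _; rewrite /q; ring.
rewrite /c0 (_ : Phi p = k * (Phi p0 - \sum_(i < n) c i * p0 (e (lift ord0 i))) +
  \sum_(i < n) c i * p (e (lift ord0 i))); last by lra.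
by rewrite /k; congr (_ + _); field.
Qed.

Lemma finite_dimensional_reflexive : finite_dimensional X -> reflexive_space X.
Proof.
move=> [n [e espan]] Phi Plin _.
have [||c Pc] := @functional_of_span n e (@dual R X) Phi _ Plin.
- exact: dual_lincomb.
- move=> p dp pe0; have p0 : p = fun v => (-1) * p v + p v.
    apply/funext => v; rewrite mulN1r addNr; have [a ->] := espan v.
    rewrite (big_morph p (functionalD dp.1) (functional0 dp.1)) big1 // => i _.
    by rewrite (functionalZ dp.1) pe0 mulr0.
  by rewrite p0 Plin // mulN1r addNr.
exists (\sum_(i < n) c i *: e i) => p dp; rewrite Pc //.
rewrite (big_morph p (functionalD dp.1) (functional0 dp.1)).
by apply: eq_bigr => i _; rewrite (functionalZ dp.1).
Qed.

End FiniteDimension.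

(** * Convex functions with values in the extended reals *)

Section ExtendedReal.
Context (R : realType) (X : normedModType R).
Implicit Types (A S : set X) (h : X -> \bar R).

Lemma dom_fineK h x : (-oo < h x)%E -> dom h x -> (fine (h x))%:E = h x.
Proof. by move=> hN hx; rewrite fineK // fin_numE gt_eqF //= lt_eqF. Qed.

Lemma convex_on_fine A h : convex_subset A -> (forall x, A x -> (-oo < h x)%E) ->
  convex_on A h ->
  convex_subset (A `&` dom h) /\ convex_real_on (A `&` dom h) (fine \o h).
Proof.
move=> Ac hN hc.
have key v w (a : R) : (A `&` dom h) v -> (A `&` dom h) w -> 0 < a < 1 ->
    (h (a *: v + (1 - a) *: w)%R <= (a * fine (h v) + (1 - a) * fine (h w))%R%:E)%E.
  move=> [Av hv] [Aw hw] a01; apply: (le_trans (hc _ _ _ Av Aw a01)).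
  by rewrite [leRHS]EFinD !EFinM !dom_fineK //; exact: hN.
have dc : convex_subset (A `&` dom h).
  move=> v w a Av Aw a01; split; first by apply: Ac => //; [exact: Av.1|exact: Aw.1].
  by apply: le_lt_trans (key _ _ _ Av Aw a01) _; rewrite ltry.
split=> // v w a Av Aw a01; rewrite -lee_fin /= dom_fineK; first exact: key.
  by apply: hN; apply: Ac => //; [exact: Av.1|exact: Aw.1].
by have [] := dc _ _ _ Av Aw a01.
Qed.

(** A ball of radius [d] around [y] contained in [A], shrunk towards [x], is a ball
    of radius [t * d] contained in [A]. *)
Lemma interior_segment A x y (t : R) : convex_subset A -> A x -> A° y -> 0 < t < 1 ->
  A° (x + t *: (y - x)).
Proof.
move=> Ac Ax /nbhs_ballP[d /= d0 dA] /andP[t0 t1].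
apply/nbhs_ballP; exists (t * d) => /=; first exact: mulr_gt0.
move=> u; rewrite -ball_normE /= => ud.
have -> : u = t *: (y + t^-1 *: (u - (x + t *: (y - x)))) + (1 - t) *: x.
  have -> : x + t *: (y - x) = t *: y + (1 - t) *: x.
    by rewrite scalerBr scalerBl scale1r addrCA.
  rewrite scalerDr scalerA divff ?gt_eqF // scale1r.
  by rewrite addrAC subrKC.
apply: Ac => //; last by rewrite t0.
apply: dA; rewrite -ball_normE /= opprD addrA subrr sub0r normrN normrZ.
by rewrite distrC gtr0_norm ?invr_gt0 // mulrC ltr_pdivrMr // mulrC.
Qed.

Lemma segment_cvg (x d : X) (t : nat -> R) : t @ \oo --> 0 ->
  x + t i *: d @[i --> \oo] --> x.
Proof.
move=> t0; rewrite -[X in _ --> X]addr0 -(scale0r d).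
by apply: cvgD; [exact: cvg_cst|exact: cvgZr_tmp].
Qed.

Lemma boundary_of_interior A x y : convex_subset A -> A x -> A° y -> ~ A° x ->
  boundary A° x.
Proof.
move=> Ac Ax Ay nAx; split; last by rewrite ((interior_id _).1 (open_interior A)).
move=> N Nx.
have t0 : (fun n => n.+2%:R^-1 : R) @ \oo --> 0.
  by have := @cvg_harmonic R; rewrite -(cvg_shiftS (@harmonic R)).
have [n Nn] : exists n : nat, N (x + n.+2%:R^-1 *: (y - x)).
  have NF : \forall n \near \oo, N (x + n.+2%:R^-1 *: (y - x)).
    exact: (@segment_cvg x (y - x) _ t0 N Nx).
  exact: filter_ex NF.
exists (x + n.+2%:R^-1 *: (y - x)); split=> //; apply: interior_segment => //.
by rewrite invr_gt0 ltr0n /= invf_lt1 ?ltr0n // ltr1n.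
Qed.

(** Dividing the chord inequality by [t] and letting [t] tend to [0] from the
    right. With [m = 0] this is the gradient inequality of convex functions, and
    with [m] below the relative gauge it bounds the Bregman divergence below. *)
Lemma le_derive_of_chord (F : X -> R) y v (m B : R) : derivable F y v ->
  (forall t : R, 0 < t < 1 ->
     F (y + t *: v) + t * (1 - t) * m <= t * B + (1 - t) * F y) ->
  'D_v F y + m <= B - F y.
Proof.
move=> dF H.
have sub : 0^'+ `=>` (0 : R)^'.
  move=> A; rewrite /at_right /dnbhs /within /=; apply: filterS => h Hh h0.
  by apply: Hh; rewrite gt_eqF.
have c1 : h^-1 *: (F (h *: v + y) - F y) @[h --> (0 : R)^'+] --> 'D_v F y.
  exact: (cvg_trans (cvg_app _ sub) dF).
have c2 : (1 - h) * m @[h --> (0 : R)^'+] --> m.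
  have : (1 - h) * m @[h --> (0 : R)^'] --> (1 - 0) * m.
    apply: cvgMl; apply: cvgB; first exact: cvg_cst.
    by apply: cvg_within_filter; exact: cvg_id.
  by rewrite subr0 mul1r; apply: cvg_trans; exact: cvg_app.
apply: (cvgr_to_le (cvgD c1 c2)).
near=> h.
have h0 : 0 < h by near: h; exact: nbhs_right_gt.
have h1 : h < 1 by near: h; exact: nbhs_right_lt.
have := H h; rewrite h0 h1 => /(_ isT) Hh.
suff : h^-1 * (F (h *: v + y) - F y) + (1 - h) * m <= B - F y by [].
rewrite -(ler_pM2l h0) mulrDr mulVKf ?gt_eqF // (addrC _ y).
by lra.
Unshelve. all: by end_near. Qed.

End ExtendedReal.

Section ConvexFunction.
Context (R : realType) (X : normedModType R) (b : X -> \bar R).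
Hypotheses (bN : forall x, (-oo < b x)%E) (bc : convex_on setT b).

Lemma dom_convex : convex_subset (dom b) /\ convex_real_on (dom b) (fine \o b).
Proof.
have [] := @convex_on_fine R X setT b (fun _ _ _ _ _ _ => I) (fun x _ => bN x) bc.
by rewrite !setTI.
Qed.

Lemma gradient_inequality x y : dom b x -> derivable (fine \o b) y (x - y) ->
  dom b y -> gateaux_gradient b y (x - y) <= fine (b x) - fine (b y).
Proof.
move=> bx dy by_; have [_ bconv] := dom_convex.
have := @le_derive_of_chord R X (fine \o b) y (x - y) 0 (fine (b x)) dy.
rewrite addr0; apply=> t t01; rewrite mulr0 addr0.
have -> : y + t *: (x - y) = t *: x + (1 - t) *: y.
  by rewrite scalerBr scalerBl scale1r addrCA.
exact: bconv.
Qed.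

End ConvexFunction.

(** By Baire's theorem one of the closed sets [b <= n] contains a ball [ball q d].
    Prolonging the segment from [q] to [p] slightly beyond [p], to a point [p'] of
    [dom b], writes the points near [p] as convex combinations of [p'] and of
    points of that ball. *)
Lemma lsc_convex_locally_bounded (R : realType) (X : completeNormedModType R)
    (b : X -> \bar R) (p : X) :
  (forall x, (-oo < b x)%E) -> convex_on setT b -> lower_semicontinuous b ->
  (dom b)° p ->
  exists r M : R, 0 < r /\
    forall v, `|v| < r -> dom b (p + v) /\ fine (b (p + v)) <= M.
Proof.
move=> bN bc blsc Up; have [dc bconv] := dom_convex bN bc.
pose F (n : nat) := [set x | (n%:R%:E < b x)%E].
have [n nF] : exists n, ~ dense (F n).
  apply: contrapT => H.
  have : dense (\bigcap_i F i).
    apply: Baire => i; split; first by have /lower_semicontinuousP := blsc; exact.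
    by apply: contrapT => Hi; apply: H; exists i.
  move=> /(_ (dom b)°) [||x [bx Fx]]; [by exists p|exact: open_interior|].
  have {}bx := interior_subset bx.
  have := Fx (Num.truncn (fine (b x))).+1 I;
  rewrite /F /= -[ltRHS](dom_fineK (bN x) bx) lte_fin.
  by rewrite ltNge ltW // truncnS_gt.
have [W [[q Oq] OF]] := (denseNE nF).
have /nbhs_ballP[d /= d0 dO] := open_nbhs_nbhs Oq.
have bO w : ball q d w -> dom b w /\ fine (b w) <= n%:R.
  move=> /dO Ow; have : (b w <= n%:R%:E)%E.
    rewrite leNgt; apply/negP => nb; suff : set0 w by [].
    by rewrite -OF; split.
  move=> bw; have dw : dom b w by apply: le_lt_trans bw _; rewrite ltry.
  by split=> //; rewrite -lee_fin dom_fineK.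
have /nbhs_ballP[e /= e0 eU] := Up.
pose k := e / (`|p - q| + 1).
have k0 : 0 < k by rewrite divr_gt0 // ltr_wpDl.
pose a := (1 + k)^-1.
have a0 : 0 < a by rewrite invr_gt0; lra.
have a1 : a < 1 by rewrite invf_lt1; lra.
have a01 : 0 < a < 1 by rewrite a0.
pose p' := q + a^-1 *: (p - q).
have dp' : dom b p'.
  apply: eU; rewrite -ball_normE /= /p' /a invrK scalerDl scale1r addrA subrKC.
  rewrite opprD addrA subrr sub0r normrN normrZ gtr0_norm // /k.
  by rewrite mulrAC ltr_pdivrMr ?ltr_wpDl // ltr_pM2l // ltrDl.
exists ((1 - a) * d), (a * fine (b p') + (1 - a) * n%:R); split.
  by rewrite mulr_gt0 //; lra.
move=> v vr.
have [dw bw] : dom b (q + (1 - a)^-1 *: v) /\ fine (b (q + (1 - a)^-1 *: v)) <= n%:R.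
  apply: bO; rewrite -ball_normE /= opprD addrA subrr sub0r normrN normrZ.
  by rewrite gtr0_norm ?invr_gt0; [rewrite mulrC ltr_pdivrMr 1?mulrC //; lra|lra].
have -> : p + v = a *: p' + (1 - a) *: (q + (1 - a)^-1 *: v).
  rewrite !scalerDr !scalerA !divff ?gt_eqF ?subr_gt0 // !scale1r.
  by rewrite addrACA (addrC (a *: q)) -scalerDl [1 - a + a]subrK scale1r addrA subrKC.
split; first exact: dc.
apply: le_trans (bconv _ _ _ dp' dw a01) _.
by rewrite lerD2l ler_pM2l //; lra.
Qed.

(** Let [p] be a subgradient at [x] and [u] a point of the segment from [x] to [y].
    Convexity between [u] and [x] gives [p (y - x) <= b' u (y - x)]; with the
    upper bound [M] of [b] near [y], convexity between [u] and [y + v] then bounds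
    [b' u v] by a constant independent of [u], so the gradients cannot blow up
    as [u] tends to [x]. *)
Lemma essentially_smooth_boundary (R : realType) (X : completeNormedModType R)
    (b : X -> \bar R) (x : X) :
  lower_semicontinuous b -> essentially_smooth b -> dom b x ->
  boundary (dom b)° x -> subdifferential b x = set0.
Proof.
move=> blsc [[y Uy] [bN0 _] bc bdiff bblow] bx xbd.
have bN z : (-oo < b z)%E by exact: bN0.
have [dc bconv] := dom_convex bN bc.
apply/seteqP; split=> // p [dp psub].
have [r [M [r0 yM]]] := lsc_convex_locally_bounded bN bc blsc Uy.
pose t (i : nat) : R := i.+2%:R^-1.
have t01 i : 0 < t i < 1 by rewrite /t invr_gt0 ltr0n /= invf_lt1 ?ltr0n // ltr1n.
pose u i := x + t i *: (y - x).
have Uu i : (dom b)° (u i) by exact: interior_segment.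
have ucvg : u i @[i --> \oo] --> x.
  apply: segment_cvg.
  by have := @cvg_harmonic R; rewrite -(cvg_shiftS (@harmonic R)).
pose K := M - fine (b x) - p (y - x).
have grad i v : `|v| < r -> gateaux_gradient b (u i) v <= K.
  move=> vr; have [gd dg] := bdiff _ (Uu i).
  have sg : scalar (gateaux_gradient b (u i)) by exact: dg.1.
  have bu : dom b (u i) := interior_subset (Uu i).
  have [bv bvM] := yM _ vr.
  have := gradient_inequality bN bc bx (gd _) bu.
  have := gradient_inequality bN bc bv (gd _) bu.
  have -> : x - u i = - t i *: (y - x) by rewrite /u opprD addrA subrr sub0r scaleNr.
  have -> : y + v - u i = (1 - t i) *: (y - x) + v.
    by rewrite /u scalerBl scale1r opprD [LHS]addrA [y + v - x]addrAC [LHS]addrAC.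
  rewrite (functionalD sg) !(functionalZ sg).
  have := psub (u i); rewrite -[b x]dom_fineK // -[b (u i)]dom_fineK //.
  rewrite -EFinD lee_fin /u addrAC subrr add0r (functionalZ dp.1) -/(u i).
  have /andP[t0 t1] := t01 i; rewrite /K.
  set g := gateaux_gradient b (u i) (y - x); move=> H1 H2 H3.
  have gp : p (y - x) <= g by rewrite -(ler_pM2l t0); lra.
  have : (1 - t i) * p (y - x) <= (1 - t i) * g by rewrite ler_pM2l //; lra.
  by lra.
have bnd i : dual_norm (gateaux_gradient b (u i)) <= 2 / r * K.
  have sg : scalar (gateaux_gradient b (u i)) by exact: (bdiff _ (Uu i)).2.1.
  apply: dual_norm_le => v v1.
  have half w : `|w| <= 1 -> gateaux_gradient b (u i) w <= 2 / r * K.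
    move=> w1; have rw : `|(r / 2) *: w| < r.
      rewrite normrZ gtr0_norm ?divr_gt0 //.
      apply: (@le_lt_trans _ _ (r / 2)); last by lra.
      by rewrite -[leRHS]mulr1 ler_pM2l //; lra.
    have := grad i _ rw; rewrite (functionalZ sg) => rK.
    rewrite (_ : gateaux_gradient b (u i) w =
        2 / r * (r / 2 * gateaux_gradient b (u i) w)).
      by rewrite ler_pM2l // divr_gt0.
    by field; lra.
  have := half v v1; have := half (- v); rewrite normrN => /(_ v1).
  by rewrite (functionalN sg) ler_norml; lra.
have /cvgryPgt/(_ (2 / r * K)) := bblow u x Uu xbd ucvg.
by move=> /filter_ex[i]; rewrite ltNge bnd.
Qed.

Lemma convex_set_subset (R : realType) (X : normedModType R) (S : set X) :
  convex_set (S : set (convex_lmodType X)) -> convex_subset S.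
Proof.
move=> Sc v w a Sv Sw /andP[a0 a1].
have := Sc v w (Itv01 (ltW a0) (ltW a1)); rewrite !inE; exact.
Qed.

(** Semicontinuity on the subspace [S], phrased with neighbourhoods in [X]. *)
Lemma lsc_on (R : realType) (X : normedModType R) (S : set X) (g : X -> \bar R)
    x (a : R) :
  lower_semicontinuous (g : subspace S -> \bar R) -> S x -> (a%:E < g x)%E ->
  \forall w \near x, S w -> (a%:E < g w)%E.
Proof.
move=> glsc Sx ax; have [V Vx Vg] := glsc x a ax.
have : within S (nbhs x) V by rewrite nbhs_subspace_in.
by rewrite /within /=; apply: filterS => w Vw Sw; exact/Vg/Vw.
Qed.

Lemma notin_dom (R : realType) (X : normedModType R) (h : X -> \bar R) x :
  ~ dom h x -> h x = +oo%E.
Proof. by move=> nhx; apply/eqP; rewrite -leye_eq leNgt; exact/negP. Qed.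

(** Lower semicontinuity bounds the function below near one point of its domain;
    convexity propagates this bound along rays, at the price of a linear loss. *)
Lemma lsc_convex_linear_lower_bound (R : realType) (X : normedModType R)
    (S : set X) (g : X -> \bar R) p :
  convex_subset S -> (forall x, S x -> (-oo < g x)%E) -> convex_on S g ->
  lower_semicontinuous (g : subspace S -> \bar R) -> S p -> dom g p ->
  exists C K : R, [/\ 0 < C & forall x, S x -> dom g x ->
    K - C * `|x - p| <= fine (g x)].
Proof.
move=> Sc gN gc glsc Sp gp; have [Dc gconv] := convex_on_fine Sc gN gc.
have lt1 : ((fine (g p) - 1)%:E < g p)%E.
  by rewrite -[ltRHS]dom_fineK ?lte_fin //; [lra|exact: gN].
have /nbhs_ballP[r /= r0 rg] := lsc_on glsc Sp lt1.
exists (2 / r), (fine (g p) - 1); split=> [|x Sx gx]; first exact: divr_gt0.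
have near1 w : S w -> dom g w -> `|w - p| < r -> fine (g p) - 1 <= fine (g w).
  move=> Sw gw wp; rewrite -lee_fin dom_fineK //; last exact: gN.
  by apply/ltW/rg => //; rewrite -ball_normE /= distrC.
have [xr|xr] := ltP `|x - p| r.
  have := near1 _ Sx gx xr.
  have : 0 <= 2 / r * `|x - p| by rewrite mulr_ge0 // divr_ge0 // ltW.
  by lra.
have n0 : 0 < `|x - p| by apply: lt_le_trans xr.
pose s := r / (2 * `|x - p|).
have s0 : 0 < s by rewrite divr_gt0 // mulr_gt0.
have s1 : s < 1 by rewrite ltr_pdivrMr ?mulr_gt0 //; lra.
have s01 : 0 < s < 1 by rewrite s0.
have [Sw gw] := Dc _ _ _ (conj Sx gx) (conj Sp gp) s01.
have wE : s *: x + (1 - s) *: p - p = s *: (x - p).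
  by rewrite scalerBl scale1r scalerBr addrA addrAC addrK.
have := near1 _ Sw gw; rewrite wE normrZ gtr0_norm // => H.
have {H}H1 : fine (g p) - 1 <= fine (g (s *: x + (1 - s) *: p)%R).
  apply: H; rewrite /s.
  have -> : r / (2 * `|x - p|) * `|x - p| = r / 2 by field; rewrite gt_eqF.
  lra.
have H2 := gconv _ _ _ (conj Sx gx) (conj Sp gp) s01.
have E : s * (2 / r * `|x - p|) = 1 by rewrite /s; field; rewrite !gt_eqF.
rewrite -(ler_pM2l s0); move: H1 H2 => /=.
by lra.
Qed.

(** * Linear perturbation of a sum of two convex functions *)

Section Minimization.
Context (R : realType) (X : normedModType R) (S : set X) (b g : X -> \bar R).
Context (l : X -> R) (y : X) (k c : R).
Hypotheses (Sc : convex_subset S) (Scl : closed S) (Sb : S `<=` dom b).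
Hypotheses (bN : forall x, (-oo < b x)%E) (bc : convex_on setT b).
Hypotheses (blsc : lower_semicontinuous b).
Hypotheses (gN : forall x, S x -> (-oo < g x)%E) (gc : convex_on S g).
Hypotheses (glsc : lower_semicontinuous (g : subspace S -> \bar R)).
Hypotheses (dl : dual l) (c_gt0 : 0 < c).

Let D := S `&` dom g.
Definition objective x := k + l (x - y) + c * fine (b x) + fine (g x).

(** If [x] is a limit of the sublevel set but not in it, then either [g x] is
    infinite or the objective exceeds [t] at [x]; in both cases some real [G],
    lowered by [e], is below [g x] and leaves room for an error [e] in each term. *)
Lemma objective_sublevel_closed (t : R) : closed [set x | D x /\ objective x <= t].
Proof.
have c0 := c_gt0.
move=> x xcl.
have Sx : S x.
  by apply: Scl => N Nx; have [w [[[Sw _] _] Nw]] := xcl N Nx; exists w.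
have bx := Sb Sx.
apply: contrapT => nt.
have [e [G [e0 Gg Gt]]] : exists e G : R, [/\ 0 < e, ((G - e)%:E < g x)%E &
    t <= k + l (x - y) + c * fine (b x) + G - (2 + c) * e].
  have [gx|gx] := pselect (dom g x).
    have : t < objective x by rewrite ltNge; apply/negP => xt; apply: nt.
    have c2 : 0 < 2 + c by lra.
    rewrite /objective; set o := (_ + fine (g x)); rewrite -subr_gt0 => to.
    exists ((o - t) / (2 + c)), (fine (g x)); split.
    - exact: divr_gt0.
    - rewrite -[ltRHS]dom_fineK //; last exact: gN.
      by rewrite lte_fin ltrBlDr ltrDl divr_gt0.
    - by rewrite [(2 + c) * _]mulrC divfK; [rewrite /o; lra|rewrite gt_eqF].
  exists 1, (t - (k + l (x - y) + c * fine (b x)) + (2 + c)); split=> //; last by lra.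
  by rewrite (notin_dom gx) ltry.
have lx : \forall w \near x, l (x - y) - e < l (w - y).
  have /cvgrPdist_lt/(_ _ e0) := dl.2 x; apply: filterS => w.
  by rewrite !(functionalB dl.1) ltr_norml; lra.
have [V Vx Vb] : exists2 V, nbhs x V & forall w, V w -> ((fine (b x) - e)%:E < b w)%E.
  by apply: blsc; rewrite -[ltRHS]dom_fineK // lte_fin ltrBlDr ltrDl.
have := lsc_on glsc Sx Gg => gnear.
have [w [[[Sw gw] wt] [lw [Vw]]]] := xcl _ (filterI lx (filterI Vx gnear)).
move=> /(_ Sw); rewrite -[g w]dom_fineK //; last exact: gN.
have := Vb _ Vw; rewrite -[b w]dom_fineK //; last exact: Sb.
rewrite !lte_fin -(ltr_pM2l c0) => bw Gw.
by move: wt; rewrite /objective; lra.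
Qed.

Lemma objective_convex : convex_real_on D objective.
Proof.
have [dc bconv] := dom_convex bN bc; have [Dc gconv] := convex_on_fine Sc gN gc.
have c0 := c_gt0.
move=> v w a Dv Dw a01; rewrite /objective.
have := gconv _ _ _ Dv Dw a01.
have := bconv _ _ _ (Sb Dv.1) (Sb Dw.1) a01; rewrite -(ler_pM2l c0) /=.
rewrite !(functionalB dl.1) (functionalD dl.1) !(functionalZ dl.1).
by lra.
Qed.

Lemma objective_minimizer_unique z z' : strictly_convex_on S b ->
  D z -> D z' -> (forall x, D x -> objective z <= objective x) ->
  (forall x, D x -> objective z' <= objective x) -> z = z'.
Proof.
have c0 := c_gt0.
move=> bstr Dz Dz' zmin zmin'; apply/eqP/negPn/negP => zz'.
have [Dc gconv] := convex_on_fine Sc gN gc.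
have h01 : 0 < (2^-1 : R) < 1 by lra.
have := bstr _ _ _ Dz.1 Dz'.1 zz' h01.
have Dm := Dc _ _ _ Dz Dz' h01.
rewrite -(dom_fineK (bN _) (Sb Dm.1)) -(dom_fineK (bN _) (Sb Dz.1)).
rewrite -(dom_fineK (bN _) (Sb Dz'.1)) -!EFinM -EFinD lte_fin -(ltr_pM2l c0).
have := gconv _ _ _ Dz Dz' h01; have := zmin _ Dm; have := zmin' _ Dz.
have := zmin _ Dz'; rewrite /objective /=.
rewrite !(functionalB dl.1) (functionalD dl.1) !(functionalZ dl.1).
by lra.
Qed.

(** The slope [s] is chosen so that [c * (s - C2)] exceeds by one the linear rates
    [C] and [C1] at which [g] and [l] can decrease, [C2] being the norm bound for
    the gradient of [b] at [y]. *)
Lemma objective_sublevel_bounded p :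
  D p -> (dom b)° y -> gateaux_differentiable (fine \o b) y ->
  (bounded_set S \/
   (~ bounded_set S /\
    exists2 psi : R -> \bar R,
      uniformly_convex_relative b S [set y] psi &
      (psi t * (t^-1)%:E)%E @[t --> +oo%R] --> +oo%E)) ->
  forall t : R, exists M : R, forall x, D x -> objective x <= t -> `|x| <= M.
Proof.
have c0 := c_gt0.
move=> Dp Uy [dy dual_b'] growth t.
case: growth => [|[_ [psi [_ _ _ psi0 psib] psioo]]].
  by move=> /pinfty_ex_gt0[M M0 SM]; exists M => x [Sx _] _; exact: SM.
have [C [K [C0 gCK]]] := lsc_convex_linear_lower_bound Sc gN gc glsc Dp.1 Dp.2.
have [C1 C10 lC1] := dual_bounded dl.
have [C2 C20 bC2] := dual_bounded dual_b'.
pose s := (C + C1 + 1) / c + C2.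
have /cvgeyPgt/(_ s) := psioo.
move=> [T [_ HT]].
pose m := `|T| + 1.
pose M1 := t - k + C * `|y - p| - K - c * fine (b y).
exists (`|y| + m + `|M1|) => x [Sx gx] xt.
have by_ : dom b y := interior_subset Uy.
have bx := Sb Sx.
rewrite -[x](subrK y) (le_trans (ler_normD _ _)) // addrC -addrA lerD2l.
have [xm|xm] := leP `|x - y| m; first by rewrite (le_trans xm) // lerDl.
have xT : T < `|x - y|.
  by apply: le_lt_trans xm; rewrite (le_trans (ler_norm T)) // lerDl.
have n0 : 0 < `|x - y| by apply: le_lt_trans xm; rewrite addr_ge0.
have psis : ((s * `|x - y|)%R%:E <= psi `|x - y|%R)%E.
  have := HT _ xT => /= /ltW; rewrite lee_pdivlMr //.
have grad : 'D_(x - y) (fine \o b) y + s * `|x - y| <= fine (b x) - fine (b y).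
  apply: le_derive_of_chord => // a a01.
  have a1 : 0 < a * (1 - a) by have /andP[? ?] := a01; rewrite mulr_gt0 //; lra.
  have -> : y + a *: (x - y) = a *: x + (1 - a) *: y.
    by rewrite scalerBr scalerBl scale1r addrCA.
  have [dc _] := dom_convex bN bc.
  have := psib a x y a01 Sx erefl.
  rewrite -(dom_fineK (bN _) (dc _ _ _ bx by_ a01)) -(dom_fineK (bN _) bx).
  rewrite -(dom_fineK (bN _) by_) -!EFinM -EFinD => H.
  rewrite -lee_fin; apply: le_trans H; rewrite EFinD leeD2l // EFinM.
  by rewrite lee_pmul2l // lte_fin.
have lx := lC1 (x - y); have bD := bC2 (x - y).
have gx' := gCK _ Sx gx.
have tri : `|x - p| <= `|x - y| + `|y - p| by rewrite -{1}(subrK y x) -addrA ler_normD.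
have := ler_norm M1.
move: xt; rewrite /objective.
move: lx bD; rewrite !ler_norml => /andP[lx _] /andP[bD _].
have {}grad : (C + C1 + 1) * `|x - y| + c * fine (b y) <= c * fine (b x).
  have : c * (s * `|x - y|) <= c * (fine (b x) - fine (b y) + C2 * `|x - y|).
    by rewrite ler_pM2l //; lra.
  have -> : c * (s * `|x - y|) = (C + C1 + 1) * `|x - y| + c * (C2 * `|x - y|).
    by rewrite /s; field; lra.
  by lra.
have {}tri : C * `|x - p| <= C * (`|x - y| + `|y - p|) by rewrite ler_pM2l.
by rewrite /M1; have := normr_ge0 T; rewrite /m; lra.
Qed.

Lemma objective_minimizer_subgradients z p (r M : R) :
  D z -> (forall x, D x -> objective z <= objective x) ->
  D p -> 0 < r -> (forall v, `|v| < r -> dom b (p + v) /\ fine (b (p + v)) <= M) ->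
  subdifferential b z !=set0 /\ subdifferential (extend_by_infty S g) z !=set0.
Proof.
have c0 := c_gt0.
move=> Dz zmin Dp r0 pM.
have [dc bconv] := dom_convex bN bc; have [Dc gconv] := convex_on_fine Sc gN gc.
have F1c : convex_real_on (dom b) (fun x => c * fine (b x)).
  move=> v w a bv bw a01; have := bconv _ _ _ bv bw a01.
  by rewrite -(ler_pM2l c0) /=; lra.
have F2c : convex_real_on D (fun x => fine (g x) + l (x - y)).
  move=> v w a Dv Dw a01; have := gconv _ _ _ Dv Dw a01.
  by rewrite !(functionalB dl.1) (functionalD dl.1) !(functionalZ dl.1) /=; lra.
have F12 x : dom b x -> D x ->
    c * fine (b z) + (fine (g z) + l (z - y)) <=
    c * fine (b x) + (fine (g x) + l (x - y)).
  by move=> _ Dx; have := zmin _ Dx; rewrite /objective; lra.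
have F1M v : `|v| < r -> dom b (p + v) /\ c * fine (b (p + v)) <= c * M.
  by move=> /pM[bv bM]; split=> //; rewrite ler_pM2l.
have [q [dq bq gq]] := subgradient_split dc F1c Dc F2c (Sb Dz.1) Dz F12 Dp r0 F1M.
split.
  exists (fun v => c^-1 * q v + (fun=> 0) v); split.
    apply: dual_lincomb => //; split; last by move=> ?; exact: cvg_cst.
    by move=> a v w; rewrite mulr0 addr0.
  move=> w; have [bw|/notin_dom->] := pselect (dom b w); last exact: leey.
  rewrite -(dom_fineK (bN z) (Sb Dz.1)) -(dom_fineK (bN w) bw) lee_fin.
  rewrite -(ler_pM2l c0) addr0 mulrDr mulVKf ?gt_eqF //; exact: bq.
exists (fun v => (-1) * q v + - l v); split.
  by apply: dual_lincomb => //; exact: dualN.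
move=> w; rewrite /extend_by_infty (mem_set Dz.1).
case: ifPn => [/set_mem Sw|_]; last exact: leey.
have [gw|/notin_dom->] := pselect (dom g w); last exact: leey.
rewrite -(dom_fineK (gN Dz.1) Dz.2) -(dom_fineK (gN Sw) gw) lee_fin.
have := gq _ (conj Sw gw); rewrite !(functionalB dl.1) (functionalB dq.1).
by lra.
Qed.

End Minimization.

(** Continuity of [b] at [p] puts [p] in the interior of [dom b]. Continuity of [g]
    is only relative to [S]: then one moves from [p] slightly towards a point of
    [S] interior to [dom b], which keeps [g] finite. *)
Lemma exists_common_interior_point (R : realType) (X : normedModType R)
    (S : set X) (b g : X -> \bar R) p :
  (forall x, (-oo < b x)%E) -> convex_on setT b -> S `<=` dom b -> convex_subset S ->
  (forall x, S x -> (-oo < g x)%E) ->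
  S `&` (dom b)° !=set0 -> S p -> dom g p ->
  {for p, continuous b} \/ {for p, continuous (g : subspace S -> \bar R)} ->
  exists x, (S `&` dom g) x /\ (dom b)° x.
Proof.
move=> bN bc Sb Sc gN [q [Sq Uq]] Sp gp.
have bp := Sb _ Sp; have [dc _] := dom_convex bN bc.
case=> [bcont|gcont].
  exists p; split=> //.
  have : b @ p --> (fine (b p))%:E by rewrite dom_fineK //; exact: bcont.
  move=> /fine_cvgP[bfin _]; apply: filterS bfin => x.
  by rewrite fin_numE /dom /= ltey => /andP[].
have : (g : subspace S -> \bar R) @ (p : subspace S) --> (fine (g p))%:E.
  by rewrite dom_fineK //; exact: gN.
move=> /fine_cvgP[gfin _].
have {gfin} : within S (nbhs p) [set x | g x \is a fin_num].
  by rewrite nbhs_subspace_in.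
rewrite /within /= => gnear.
have t0 : (fun n => n.+2%:R^-1 : R) @ \oo --> 0.
  by have := @cvg_harmonic R; rewrite -(cvg_shiftS (@harmonic R)).
have NF : \forall n \near \oo, S (p + n.+2%:R^-1 *: (q - p)) ->
    g (p + n.+2%:R^-1 *: (q - p)) \is a fin_num.
  exact: (@segment_cvg _ _ p (q - p) _ t0 _ gnear).
have [n gn] := filter_ex NF.
have n01 : 0 < (n.+2%:R^-1 : R) < 1.
  by rewrite invr_gt0 ltr0n /= invf_lt1 ?ltr0n // ltr1n.
have Sn : S (p + n.+2%:R^-1 *: (q - p)).
  have -> : p + n.+2%:R^-1 *: (q - p) = n.+2%:R^-1 *: q + (1 - n.+2%:R^-1) *: p.
    by rewrite scalerBr scalerBl scale1r addrCA.
  exact: Sc.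
exists (p + n.+2%:R^-1 *: (q - p)); split; last exact: interior_segment.
split=> //; have := gn Sn.
by rewrite fin_numE /dom /= ltey => /andP[].
Qed.

(** * The Bregman surrogate *)

Section BregmanSurrogate.
Context (R : realType) (X : normedModType R) (S : set X) (b g : X -> \bar R).
Context (f : X -> R) (L mu : R) (y : X).
Hypotheses (Sb : S `<=` dom b) (bN : forall x, (-oo < b x)%E).
Hypotheses (gN : forall x, S x -> (-oo < g x)%E) (Uy : (dom b)° y).

(** The linear part of the surrogate: the gradient of [f] at [y], and the gradient
    term of the Bregman divergence. *)
Definition surrogate_slope v := - (L / mu) * gateaux_gradient b y v + 'D_v f y.

Lemma Qfun_objective x : S x -> dom g x -> Qfun b f g L mu x y =
  (objective b g surrogate_slope y (f y - L / mu * fine (b y)) (L / mu) x)%:E.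
Proof.
move=> Sx gx; rewrite /Qfun /bregman (mem_set (Sb Sx)) (mem_set Uy) /=.
rewrite -(dom_fineK (bN x) (Sb Sx)) -(dom_fineK (bN y) (interior_subset Uy)).
rewrite -(dom_fineK (gN Sx) gx) -!EFinB -EFinM -!EFinD; congr (_%:E).
by rewrite /objective /surrogate_slope /=; ring.
Qed.

Lemma Qfun_infty x : S x -> ~ dom g x -> Qfun b f g L mu x y = +oo%E.
Proof.
move=> Sx /notin_dom gx; rewrite /Qfun /bregman (mem_set (Sb Sx)) (mem_set Uy) /=.
rewrite -(dom_fineK (bN x) (Sb Sx)) -(dom_fineK (bN y) (interior_subset Uy)) gx.
by rewrite -!EFinB -EFinM -!EFinD.
Qed.

Lemma minimizer_objective z : S `&` dom g !=set0 ->
  minimizer S (fun x => Qfun b f g L mu x y) z <->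
  (S `&` dom g) z /\ forall x, (S `&` dom g) x ->
    objective b g surrogate_slope y (f y - L / mu * fine (b y)) (L / mu) z <=
    objective b g surrogate_slope y (f y - L / mu * fine (b y)) (L / mu) x.
Proof.
move=> [p [Sp gp]]; split=> [[Sz zmin]|[[Sz gz] zmin]].
  have gz : dom g z.
    apply: contrapT => gz; have := zmin _ Sp.
    by rewrite Qfun_infty // Qfun_objective // leye_eq.
  split=> // x [Sx gx]; rewrite -lee_fin -!Qfun_objective //; exact: zmin.
split=> // x Sx; have [gx|gx] := pselect (dom g x).
  by rewrite !Qfun_objective // lee_fin; exact: zmin.
by rewrite (Qfun_infty Sx gx) leey.
Qed.

End BregmanSurrogate.

(** * Location of the minimizer *)

Theorem lemma8p7 (R : realType) (X : completeNormedModType R)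
    (b : X -> \bar R) (S : set X) (f : X -> R) (g : X -> \bar R)
    (L mu : R) (y : X) :
  let U := (dom b)° in
  (exists x : X, x != 0) ->
  lower_semicontinuous b -> convex_on setT b -> proper_on setT b ->
  U !=set0 ->
  (forall x, U x -> gateaux_differentiable (fine \o b) x) ->
  S `<=` dom b -> S !=set0 -> closed S ->
  convex_set (S : set (convex_lmodType X)) ->
  S `&` U !=set0 ->
  strictly_convex_on S b ->
  (forall x, U x -> gateaux_differentiable f x) ->
  proper_on S g -> lower_semicontinuous (g : subspace S -> \bar R) ->
  convex_on S g ->
  (exists2 p : X, (S `&` dom g) p &
     {for p, continuous b} \/
     {for p, continuous (g : subspace S -> \bar R)}) ->
  0 < L -> 0 < mu -> U y ->
  (bounded_set S \/
   (~ bounded_set S /\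
    exists2 psi : R -> \bar R,
      uniformly_convex_relative b S [set y] psi &
      (psi t * (t^-1)%:E)%E @[t --> +oo%R] --> +oo%E)) ->
  (reflexive_space X ->
   (S `<=` U \/
    (forall x, (S `&` boundary U) x ->
       subdifferential b x = set0 \/
       subdifferential (extend_by_infty S g) x = set0)) ->
   exists z : X,
     unique (minimizer S (fun x => Qfun b f g L mu x y)) z /\ (S `&` U) z) /\
  (finite_dimensional X -> essentially_smooth b ->
   exists z : X,
     unique (minimizer S (fun x => Qfun b f g L mu x y)) z /\ (S `&` U) z).
Proof.
move=> U _ blsc bc bproper U0 bdiff Sb S0 Scl /convex_set_subset Sc SU bstr fdiff
  [gN [d Sd gd]] glsc gc [p0 [Sp0 gp0] cont] L0 mu0 Uy growth.
have bN x : (-oo < b x)%E by exact: bproper.1.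
have c0 : 0 < L / mu by exact: divr_gt0.
have D0 : S `&` dom g !=set0 by exists d.
pose l := surrogate_slope b f L mu y.
have dl : dual l by apply: dual_lincomb; [exact: (bdiff _ Uy).2|exact: (fdiff _ Uy).2].
pose h := objective b g l y (f y - L / mu * fine (b y)) (L / mu).
have minE z : minimizer S (fun x => Qfun b f g L mu x y) z <->
    (S `&` dom g) z /\ forall x, (S `&` dom g) x -> h z <= h x.
  exact: minimizer_objective.
have [dc _] := dom_convex bN bc.
have [Dc _] := convex_on_fine Sc gN gc.
have hconv : convex_real_on (S `&` dom g) h by exact: objective_convex.
have main : reflexive_space X ->
   (S `<=` U \/
    (forall x, (S `&` boundary U) x ->
       subdifferential b x = set0 \/
       subdifferential (extend_by_infty S g) x = set0)) ->
   exists z : X,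
     unique (minimizer S (fun x => Qfun b f g L mu x y)) z /\ (S `&` U) z.
  move=> Xrefl AB.
  have [|z Dz zmin] := @reflexive_minimizer R X (S `&` dom g) h Xrefl D0.
    move=> t; split.
    - exact: objective_sublevel_closed.
    - move=> v w a [Dv vt] [Dw wt] a01; split; first exact: Dc.
      apply: le_trans (hconv _ _ _ Dv Dw a01) _.
      have /andP[a0 a1] := a01.
      have : a * h v <= a * t by rewrite ler_pM2l.
      have : (1 - a) * h w <= (1 - a) * t by rewrite ler_pM2l //; lra.
      by lra.
    - exact: (objective_sublevel_bounded _ Sc Sb bN bc gN gc glsc dl c0 (conj Sd gd)
        Uy (bdiff _ Uy) growth).
  exists z; split.
    split; first exact/minE.
    move=> z' /minE[Dz' zmin']; exact: objective_minimizer_unique zmin zmin'.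
  split; first exact: Dz.1.
  apply: contrapT => nUz; case: AB => [SsubU|AB]; first by apply/nUz/SsubU/Dz.1.
  have [p [Dp Up]] := exists_common_interior_point bN bc Sb Sc gN SU Sp0 gp0 cont.
  have [r [M [r0 pM]]] := lsc_convex_locally_bounded bN bc blsc Up.
  have [] := objective_minimizer_subgradients Sc Sb bN bc gN gc dl c0 Dz zmin Dp r0 pM.
  have zbd : boundary U z by exact: boundary_of_interior (Sb _ Dz.1) Uy nUz.
  by case: (AB z (conj Dz.1 zbd)) => ->; [move=> [q []]|move=> _ [q []]].
split=> // /finite_dimensional_reflexive Xrefl bsmooth.
apply: main => //; right=> x [Sx xbd]; left.
exact: essentially_smooth_boundary bsmooth (Sb _ Sx) xbd.
Qed.
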